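(* If $n$, $a$ and $k$ are integers such that $n=k(a-1)$, $a\ge 4$ and $k\ge 3$, then $$\beta_b(\overrightarrow{C}(n;1,a)) = \beta_b(\overrightarrow{C}(n;1,-(n-a))) = (a-2)k.$$
   Context: For integers $n\ge 3$ and $b_1,\dots,b_k$, the oriented circulant graph $\overrightarrow{C}(n;b_1,\dots,b_k)$ has vertex set $\{v_0,\dots,v_{n-1}\}$ and arc set $\{v_iv_{i+b_j} : 0\le i\le n-1,\ 1\le j\le k\}$, with subscripts taken modulo $n$ (negative $b_j$ allowed). $d(u,v)$ is the length of a shortest directed path from $u$ to $v$; $e(v)=\max_u d(v,u)$ is the eccentricity; $\mathrm{diam}$ is the maximum eccentricity. An independent broadcast on an oriented graph $\overrightarrow{G}$ is a function $f:V(\overrightarrow{G})\to\{0,\dots,\mathrm{diam}(\overrightarrow{G})\}$ with $f(v)\le e(v)$ for all $v$, and $d(u,v)>f(u)$ for all distinct $u,v$ with $f(u),f(v)>0$. Its cost is $\sigma(f)=\sum_v f(v)$, and $\beta_b(\overrightarrow{G})$ is the maximum cost of an independent broadcast on $\overrightarrow{G}$. *)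

(* Defs.v *)
From mathcomp Require Import all_boot all_order all_algebra.

Set Implicit Arguments.
Unset Strict Implicit.
Unset Printing Implicit Defensive.

Section Digraph.

Variables (T : finType) (e : rel T).

Definition has_dipath (u v : T) (l : nat) : bool :=
  [exists p : l.-tuple T, [&& path e u p, last u p == v & uniq (u :: p)]].

(* The search range is exhaustive, since a directed path has fewer than #|T|
   arcs; the value #|T| stands for an infinite distance (see dist_lt_card). *)
Definition dist (u v : T) : nat := find (has_dipath u v) (iota 0 #|T|).

Definition ecc (v : T) : nat := \max_(u : T) dist v u.

Definition diam : nat := \max_(v : T) ecc v.

Definition indep_broadcast (f : {ffun T -> 'I_diam.+1}) : bool :=
  [forall v, f v <= ecc v] &&
  [forall u, forall v,
     [&& u != v, 0 < f u & 0 < f v] ==> (f u < dist u v)].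

Definition cost (f : {ffun T -> 'I_diam.+1}) : nat := \sum_(v : T) f v.

(* The constantly zero function is an independent broadcast, so this maximum
   is never taken over an empty set. *)
Definition broadcast_indep_number : nat :=
  \max_(f : {ffun T -> 'I_diam.+1} | indep_broadcast f) cost f.

Lemma has_dipathP u v l :
  reflect (exists p, [/\ path e u p, last u p = v, uniq (u :: p) & size p = l])
          (has_dipath u v l).
Proof.
apply: (iffP existsP) => [[p /and3P[pP /eqP pv pU]] | [p [pP pv pU /eqP sp]]].
  by exists p; rewrite size_tuple.
by exists (Tuple sp); rewrite /= in pU *; rewrite pP pv eqxx pU.
Qed.

Lemma dist_le_size u p : path e u p -> dist u (last u p) <= size p.
Proof.
move=> eup; case/shortenP: (eup) => q euq uq qp.
have sq : size q < #|T|.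
  by have := max_card (mem (u :: q)); rewrite (card_uniqP uq).
have sqp : size q <= size p.
  by move: uq; rewrite cons_uniq => /andP[_ uq]; apply: uniq_leq_size.
apply: leq_trans sqp; rewrite leqNgt; apply/negP => lt_q.
have := before_find 0 lt_q; rewrite nth_iota // add0n.
by move/has_dipathP; apply; exists q.
Qed.

Lemma dist_lt_card u v : (dist u v < #|T|) = connect e u v.
Proof.
apply/idP/connectP => [lt_d | [p eup ->]].
  have : has (has_dipath u v) (iota 0 #|T|) by rewrite has_find size_iota.
  by case/hasP => l _ /has_dipathP[p [eup <- _ _]]; exists p.
case/shortenP: eup => q euq uq _.
apply: leq_ltn_trans (dist_le_size euq) _.
by have := max_card (mem (u :: q)); rewrite (card_uniqP uq).
Qed.

Lemma dist_attained u v : connect e u v ->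
  exists p, [/\ path e u p, last u p = v, uniq (u :: p) & size p = dist u v].
Proof.
rewrite -dist_lt_card => lt_d; apply/has_dipathP.
have := @nth_find _ 0 (has_dipath u v) (iota 0 #|T|).
by rewrite has_find size_iota nth_iota // add0n; apply.
Qed.

Lemma indep_broadcast0 : indep_broadcast [ffun=> ord0].
Proof.
by apply/andP; split; apply/forallP => u; [|apply/forallP => v];
  rewrite !ffunE ?andbF.
Qed.

End Digraph.

(* The arc relation of the circulant graph; the vertex v_i is i : 'I_n. *)
Definition circulant (n : nat) (bs : seq int) : rel 'I_n :=
  fun i j => has (fun b => (i%:Z + b == j%:Z %[mod n])%Z) bs.

(* Main.v *)
(* Put m = a - 1, so that n = k m and a is 1 modulo m.  Both graphs have the arcs
   i -> i + 1 and i -> i + m + 1, and the vertices reached by walks of length t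
   are the i + t + m s with s <= t.

   Upper bound: for g = r + m j with r < m this gives d(v, v + g) <= r + m q,
   where q is least with j <= r + (m + 1) q, and hence
   m (d(v, v + g) - 1) <= (m - 1) g.  If g is the distance along the cycle
   i -> i + 1 from a broadcasting vertex v to the next one, then
   f(v) <= d(v, v + g) - 1, so m f(v) <= (m - 1) g.  The gaps g add up to n.  A
   single broadcasting vertex has g = n, and then the bound on the eccentricity
   replaces the bound on d(v, v + g).

   Lower bound: a walk of length t shifts the residue modulo m by t, so two
   distinct multiples of m are at distance at least m, and the value m - 1 on
   the k multiples of m is an independent broadcast. *)
Require Import Defs.
From mathcomp Require Import all_boot all_order all_algebra.
From mathcomp Require Import zify.

(** * Inequalities behind the distance bounds *)

Lemma gap_arith m r j q : 2 <= m -> r + m.+1 * q < j ->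
  m * (r + m * q.+1).-1 <= (m - 1) * (r + m * j).
Proof.
case: m => // m m_gt0 jlt; rewrite subSS subn0.
(* Here [m] is one less than in the statement. Once the term [m * r] on the right is dropped,
   dividing the goal by [m.+1] leaves exactly this. *)
have le_j : r + m.+1 * q + m <= m * j.
  apply: (@leq_trans (m * (r + m.+2 * q).+1)); last by rewrite leq_mul2l jlt orbT.
  have : r <= m * r by rewrite leq_pmull.
  have : m.+1 * q <= m * (m.+2 * q) by nia.
  lia.
have -> : (r + m.+1 * q.+1).-1 = r + m.+1 * q + m by lia.
rewrite [X in _ <= X]mulnDr (mulnCA m); apply: leq_trans (leq_addl _ _).
by rewrite leq_mul2l le_j.
Qed.

Lemma diam_arith m r j q k : 2 <= m -> r + m.+1 * q < j -> j < k ->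
  r + m * q.+1 <= (m - 1) * k.
Proof.
case: m => // m m_gt0 jlt jk; rewrite subSS subn0.
apply: (@leq_trans (m * (r + m.+2 * q).+2)); last by rewrite leq_mul2l; lia.
have : r <= m * r by rewrite leq_pmull.
have : m.+1 * q <= m * (m.+2 * q) by nia.
lia.
Qed.

(** * Walks and distances *)

Section Circulant.

Set Implicit Arguments.
Unset Strict Implicit.

Variables (n m k : nat) (e : rel 'I_n).
Hypotheses (hn : n = k * m) (hm : 3 <= m) (hk : 3 <= k).
Hypothesis he : forall i j : 'I_n,
  e i j = ((i + 1) %% n == j) || ((i + m.+1) %% n == j).

Let n_gt0 : 0 < n. Proof. by rewrite hn muln_gt0; lia. Qed.

Definition shift (v : 'I_n) (g : nat) : 'I_n :=
  Ordinal (ltn_pmod (v + g) n_gt0).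

Lemma shift_inj_in v g h : g < n -> h < n -> shift v g = shift v h -> g = h.
Proof.
move=> gn hn' /(congr1 val)/= /eqP; rewrite eqn_modDl.
by rewrite !modn_small // => /eqP.
Qed.

Lemma shift0 v : shift v 0 = v.
Proof. by apply: val_inj; rewrite /= addn0 modn_small. Qed.

Lemma shift_n v : shift v n = v.
Proof. by apply: val_inj; rewrite /= modnDr modn_small. Qed.

Lemma shiftD v g h : shift (shift v g) h = shift v (g + h).
Proof. by apply: val_inj; rewrite /= modnDml addnA. Qed.

Lemma shift_sub (u v : 'I_n) : exists2 g, g < n & v = shift u g.
Proof.
exists ((v + (n - u)) %% n); first exact: ltn_pmod.
apply: val_inj; rewrite /= modnDmr addnCA subnKC; last exact: ltnW.
by rewrite modnDr modn_small.
Qed.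

(** [s] counts the long arcs, of step [m.+1], each adding an extra [m]; they are taken first. *)
Lemma walk v t s : s <= t ->
  exists p, [/\ path e v p, last v p = shift v (t + m * s) & size p = t].
Proof.
elim: t s v => [|t IH] s v.
  rewrite leqn0 => /eqP ->; exists [::]; split=> //=.
  by apply: val_inj; rewrite /= muln0 !addn0 modn_small.
case: s => [|s] st.
  have [p [ep lp sp]] := IH 0 (shift v 1) (leq0n t).
  exists (shift v 1 :: p); split=> /=; last by rewrite sp.
    by rewrite ep he eqxx.
  by rewrite lp shiftD; congr shift; lia.
have [p [ep lp sp]] := IH s (shift v m.+1) st.
exists (shift v m.+1 :: p); split=> /=; last by rewrite sp.
  by rewrite ep he eqxx orbT.
by rewrite lp shiftD; congr shift; lia.
Qed.

Lemma dist_shift_le v t s : s <= t -> dist e v (shift v (t + m * s)) <= t.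
Proof.
move=> /(walk v)[p [ep <- sp]].
by rewrite -[X in _ <= X]sp; apply: dist_le_size.
Qed.

(** A walk of length [r + m * q] with [j - q] long arcs ends there; the second hypothesis says that
    this many long arcs fit. *)
Lemma dist_quotient v r j q : q <= j -> j <= r + m.+1 * q ->
  dist e v (shift v (r + m * j)) <= r + m * q.
Proof.
move=> qj jq; have -> : r + m * j = r + m * q + m * (j - q).
  by rewrite -addnA -mulnDr subnKC.
by apply: dist_shift_le; lia.
Qed.

(** The least [q] satisfying the second inequality is at most [j], because [j] satisfies it. The
    last clause records minimality. *)
Lemma exists_quotient r j : exists q,
  [/\ q <= j, j <= r + m.+1 * q & 0 < q -> r + m.+1 * q.-1 < j].
Proof.
have ex : exists q, j <= r + m.+1 * q by exists j; nia.
case: (ex_minnP ex) => q jq qmin; exists q; split=> //.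
  by apply: qmin; nia.
by case: q {jq} qmin => // q qmin _ /=; rewrite ltnNge; apply/negP => /qmin; lia.
Qed.

Lemma dist_shift_bound v g :
  m * (dist e v (shift v g)).-1 <= (m - 1) * g.
Proof.
have r_lt : g %% m < m by rewrite ltn_mod; lia.
rewrite (divn_eq g m) addnC (mulnC _ m).
move: (g %% m) (g %/ m) r_lt => r j r_lt.
have [q [qj jq qmin]] := exists_quotient r j.
have := dist_quotient v qj jq; set d := dist _ _ _ => d_le.
apply: (@leq_trans (m * (r + m * q).-1)); first by rewrite leq_mul2l; lia.
(* For [q = 0] it suffices that [m * r.-1 <= (m - 1) * r], which follows from [r < m]. *)
case: q qmin {qj jq d_le} => [|q] qmin; first by rewrite muln0 addn0; nia.
have {qmin} := qmin isT; rewrite /= => jlt.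
by apply: gap_arith => //; lia.
Qed.

Lemma dist_le v u : dist e v u <= (m - 1) * k.
Proof.
have [g g_lt ->] := shift_sub v u.
have r_lt : g %% m < m by rewrite ltn_mod; lia.
have j_lt : g %/ m < k by rewrite ltn_divLR; [rewrite -hn | lia].
rewrite (divn_eq g m) addnC (mulnC _ m).
move: (g %% m) (g %/ m) r_lt j_lt => r j r_lt j_lt.
have [q [qj jq qmin]] := exists_quotient r j.
apply: leq_trans (dist_quotient v qj jq) _.
case: q qmin {qj jq} => [|q] qmin; first by rewrite muln0 addn0; nia.
have {qmin} := qmin isT; rewrite /= => jlt.
by apply: diam_arith jlt j_lt; lia.
Qed.

Lemma ecc_le v : ecc e v <= (m - 1) * k.
Proof. by apply/bigmax_leqP => u _; apply: dist_le. Qed.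

(** * Upper bound *)

(** The cyclic intervals of length [gap v] starting at the vertices of [P] are disjoint, as none
    meets [P] beyond its start. *)
Lemma sum_gaps (P : pred 'I_n) (gap : 'I_n -> nat) :
  (forall v, gap v <= n) ->
  (forall v i, 0 < i < gap v -> ~~ P (shift v i)) ->
  \sum_(v | P v) gap v <= n.
Proof.
move=> gap_le gapP.
pose A := [set x : 'I_n * 'I_n | P x.1 && (x.2 < gap x.1)].
have A_inj : {in A &, injective (fun x : 'I_n * 'I_n => shift x.1 x.2)}.
  (* An overlap with [i <= j] puts [v] at offset [j - i] in the interval of [w], and [gapP] forces
     that offset to be 0. *)
  have base v w (i j : 'I_n) : P v -> i <= j -> j < gap w ->
      shift v i = shift w j -> (v, i) = (w, j).
    move=> Pv ij jw eq_s.
    have vw : v = shift w (j - i).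
      have := congr1 (shift^~ (n - i)) eq_s.
      have -> : shift (shift v i) (n - i) = v.
        by rewrite shiftD subnKC ?shift_n // ltnW.
      move=> ->; rewrite shiftD.
      have -> : j + (n - i) = (j - i) + n by have := ltn_ord i; lia.
      by rewrite -shiftD shift_n.
    have ji : j = i.
      apply/val_inj/eqP; rewrite eqn_leq ij andbT leqNgt; apply/negP => lt_ij.
      move: Pv; rewrite vw; apply/negP/gapP; rewrite subn_gt0 lt_ij.
      exact: leq_ltn_trans (leq_subr _ _) jw.
    by rewrite vw ji subnn shift0.
  move=> [v i] [w j]; rewrite !inE /= => /andP[Pv iv] /andP[Pw jw] eq_s.
  by case/orP: (leq_total i j) => ij; [|symmetry]; apply: base.
have <- : #|A| = \sum_(v | P v) gap v.
  rewrite -sum1_card (eq_bigl (fun x : 'I_n * 'I_n => P x.1 && (x.2 < gap x.1)));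
    last by move=> x; rewrite inE.
  rewrite -(pair_big_dep P (fun v (i : 'I_n) => i < gap v) (fun _ _ => 1)) /=.
  apply: eq_bigr => v _.
  by rewrite -(big_ord_widen _ (fun _ => 1)) // sum1_card card_ord.
by rewrite -(card_in_imset A_inj) -[X in _ <= X]card_ord max_card.
Qed.

Lemma broadcast_indep_le : broadcast_indep_number e <= (m - 1) * k.
Proof.
apply/bigmax_leqP => f /andP[/forallP f_ecc /forallP f_ind].
pose P := [pred v | 0 < f v].
have exg v : exists g, (0 < g) && ((g == n) || P (shift v g)).
  by exists n; rewrite n_gt0 eqxx.
(* [P (shift v n)] is [P v], so [gap v = n] when no other vertex broadcasts. *)
pose gap v := ex_minn (exg v).
have gap_le v : gap v <= n.
  by rewrite /gap; case: ex_minnP => g _; apply; rewrite n_gt0 eqxx.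
have gapP v i : 0 < i < gap v -> ~~ P (shift v i).
  rewrite /gap; case: ex_minnP => g _ gmin /andP[i0 ig]; apply/negP => Pi.
  by have := gmin i; rewrite i0 Pi orbT leqNgt ig => /(_ isT).
have gap_bound v : P v -> m * f v <= (m - 1) * gap v.
  move=> Pv; rewrite /gap; case: ex_minnP => g /andP[g_gt0 gP] gmin.
  have [gn|gn] := eqVneq g n.
    rewrite gn [X in _ <= _ * X]hn mulnA (mulnC m) leq_mul2r.
    by rewrite (leq_trans (f_ecc v)) ?ecc_le ?orbT.
  move: gP; rewrite (negPf gn) /= => Pg.
  have g_lt : g < n by rewrite ltn_neqAle gn gmin // n_gt0 eqxx.
  have v_neq : v != shift v g.
    apply/eqP => vE; have := @shift_inj_in v 0 g n_gt0 g_lt.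
    by rewrite -vE shift0 => /(_ erefl) g0; rewrite -g0 in g_gt0.
  have lt_d : f v < dist e v (shift v g).
    by apply: (implyP (forallP (f_ind v) (shift v g))); apply/and3P.
  apply: leq_trans (dist_shift_bound v g); rewrite leq_mul2l -ltnS.
  by rewrite prednK ?lt_d ?orbT //; apply: leq_ltn_trans lt_d.
have m_gt0 : 0 < m by lia.
rewrite -(leq_pmul2l m_gt0).
apply: (@leq_trans (\sum_(v | P v) (m - 1) * gap v)).
  rewrite /cost (bigID P) /= [X in _ + X]big1 ?addn0.
    by rewrite big_distrr /=; apply: leq_sum.
  by move=> v; rewrite lt0n negbK => /eqP.
rewrite -big_distrr /= mulnCA leq_mul2l (mulnC m k) -hn.
by rewrite sum_gaps ?orbT.
Qed.

(** * Lower bound *)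

Lemma modn_last_path u p : path e u p -> last u p = u + size p %[mod m].
Proof.
elim: p u => [|w p IH] u /=; first by rewrite addn0.
case/andP=> uw /IH ->.
have m_dvd_n : m %| n by rewrite hn dvdn_mull.
have wE : w = u + 1 %[mod m].
  move: uw; rewrite he => /orP[] /eqP <-; rewrite modn_dvdm //.
  by rewrite -[m.+1]addn1 addnCA modnDl.
by rewrite -modnDml wE modnDml -addnA.
Qed.

Lemma dist_multiples (u v : 'I_n) :
  m %| u -> m %| v -> u != v -> m - 1 < dist e u v.
Proof.
move=> mu mv uv; have m_gt0 : 0 < m by lia.
have m_le_n : m <= n by rewrite hn; nia.
rewrite ltnNge; apply/negP => d_lt.
(* The value [n] encodes an infinite distance; being below it yields an actual path. *)
have : dist e u v < #|'I_n| by rewrite card_ord; lia.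
rewrite dist_lt_card => /dist_attained[p [ep lp _ sp]].
have := modn_last_path ep; rewrite lp -modnDml.
rewrite (eqP mu) (eqP mv) add0n modn_small; last by rewrite sp; lia.
by case: p lp {ep sp} => // uE; rewrite -uE eqxx in uv.
Qed.

(** This makes [m - 1] an admissible value at [v]; the witness is the next multiple of [m] on the
    cycle. *)
Lemma ecc_multiple (v : 'I_n) : m %| v -> m - 1 <= ecc e v.
Proof.
move=> mv.
have m_dvd_n : m %| n by rewrite hn dvdn_mull.
have m_lt_n : m < n by rewrite hn; nia.
apply: (@leq_trans (dist e v (shift v m))); last exact: leq_bigmax.
apply/ltnW/dist_multiples => //.
  by rewrite /dvdn /= modn_dvdm // modnDr.
apply/eqP => vE; have := @shift_inj_in v 0 m n_gt0 m_lt_n.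
by rewrite -vE shift0 => /(_ erefl); lia.
Qed.

Lemma card_multiples : k <= #|[pred v : 'I_n | m %| v]|.
Proof.
have lt_n (j : 'I_k) : j * m < n.
  by rewrite hn ltn_pmul2r; [exact: ltn_ord | lia].
have inj : injective (fun j => Ordinal (lt_n j)).
  move=> i j /(congr1 val)/= /eqP; rewrite eqn_pmul2r; last by lia.
  by move/eqP/val_inj.
rewrite -[X in X <= _](card_ord k) -(card_codom inj).
apply: subset_leq_card; apply/subsetP => _ /codomP[j ->].
by rewrite inE /= dvdn_mull.
Qed.

Lemma broadcast_indep_ge : (m - 1) * k <= broadcast_indep_number e.
Proof.
have m_le_diam : m - 1 < (diam e).+1.
  have m0 : m %| Ordinal n_gt0 by rewrite dvdn0.
  by rewrite ltnS (leq_trans (ecc_multiple m0)) // /diam leq_bigmax.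
pose f := [ffun v : 'I_n => if m %| v then Ordinal m_le_diam else ord0].
have f_ind : indep_broadcast f.
  apply/andP; split; apply/forallP => u.
    by rewrite ffunE; case: ifP => // mu; apply: ecc_multiple.
  apply/forallP => v; apply/implyP; rewrite !ffunE.
  case: ifP => [mu|_]; last by rewrite andbF.
  case: ifP => [mv|_]; last by rewrite !andbF.
  by case/and3P=> uv _ _; apply: dist_multiples.
apply: leq_trans (leq_bigmax_cond _ f_ind).
apply: (@leq_trans (\sum_(v : 'I_n | m %| v) (m - 1))).
  by rewrite sum_nat_const mulnC leq_mul2r card_multiples orbT.
rewrite /cost [X in _ <= X](bigID (fun v : 'I_n => m %| v)) /=.
by apply: leq_trans (leq_addr _ _); apply: leq_sum => v mv; rewrite ffunE mv.
Qed.

Lemma broadcast_indep_numberE : broadcast_indep_number e = (m - 1) * k.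
Proof. by apply/eqP; rewrite eqn_leq broadcast_indep_le broadcast_indep_ge. Qed.

End Circulant.

(** * The two circulant graphs *)

Lemma circulant_arc n b1 b2 (c1 c2 : int) (i j : 'I_n) :
  (c1 = b1%:Z %[mod n])%Z -> (c2 = b2%:Z %[mod n])%Z ->
  circulant [:: c1; c2] i j = ((i + b1) %% n == j) || ((i + b2) %% n == j).
Proof.
move=> h1 h2.
have arc (c : int) b : (c = b%:Z %[mod n])%Z ->
    (i%:Z + c == j%:Z %[mod n])%Z = ((i + b) %% n == j).
  move=> h; rewrite -intdiv.modzDmr h intdiv.modzDmr.
  by rewrite -PoszD !intdiv.modz_nat eqz_nat (modn_small (ltn_ord j)).
by rewrite /circulant /= orbF (arc _ b1) // (arc _ b2).
Qed.

Theorem theorem25 (n a k : nat) (hn : n = k * (a - 1)) (ha : 4 <= a)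
    (hk : 3 <= k) :
  broadcast_indep_number (@circulant n [:: 1; a%:Z]%R) =
    broadcast_indep_number (@circulant n [:: 1; - (n%:Z - a%:Z)]%R)
  /\
  broadcast_indep_number (@circulant n [:: 1; - (n%:Z - a%:Z)]%R) =
    (a - 2) * k.
Proof.
case: a ha hn => // m hm; rewrite subSS subn0 => hn.
have -> : m.+1 - 2 = m - 1 by lia.
rewrite !(@broadcast_indep_numberE n m k) // => i j; apply: circulant_arc => //.
(* The second step is [a - n], congruent to [a] modulo [n], so both graphs have the same arcs. *)
by rewrite GRing.opprB -[LHS]intdiv.modzDr GRing.subrK.
Qed.
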